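(* Let $(C,X,F,Y)$ be random elements of standard Borel spaces such that $F-(X,C)-Y$ is a Markov chain. Let $L:\mathcal Q\times\mathcal F\to\overline{\mathbb R}$ be proper on $\mathcal Q\subseteq\mathcal P(\mathcal F)$, suppose that $S_X,S_Y\in\mathcal Q$ almost surely, let $\mathcal V$ be a nonempty class of measurable predictive kernels with $Q(\cdot\mid Y,C)\in\mathcal Q$ almost surely for every $Q\in\mathcal V$, let $Q_\theta\in\mathcal V$, and assume that all risks $H_L(F\mid X,C)$, $H_L(F\mid Y,C)$, $H_{L,\mathcal V}(F\mid Y,C)$, $\mathcal R_L(Q_\theta)$ are finite. Then $$\mathcal R_L(Q_\theta)=H_L(F\mid X,C),$$ or, equivalently, $\mathbb E\,D_L(S_X\|Q_\theta(\cdot\mid Y,C))=0$, if and only if $$\Delta_{\rm comm}=\Delta_{\rm family}^{\mathcal V}=\Delta_{\rm deploy}^{\theta}=0.$$ If $L$ is strictly proper on $\mathcal Q$, then $\Delta_{\rm comm}=0$ is equivalent to $S_X=S_Y$ almost surely, or, under $F-(X,C)-Y$, to $F\perp\!\!\!\perp X\mid(Y,C)$. If, in addition, the infimum defining $H_{L,\mathcal V}(F\mid Y,C)$ is attained, with $Q_{\mathcal V}^\star\in\arg\min_{Q\in\mathcal V}\mathcal R_L(Q)$, then $$\Delta_{\rm family}^{\mathcal V}=0\iff Q_{\mathcal V}^\star(\cdot\mid Y,C)=S_Y\ \text{almost surely},$$ and $$\Delta_{\rm deploy}^{\theta}=0\iff Q_\theta\in\arg\min_{Q\in\mathcal V}\mathcal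 R_L(Q).$$ Thus, under strict properness and attainment, $\mathcal R_L(Q_\theta)=H_L(F\mid X,C)$ requires all three of: (i) $F\perp\!\!\!\perp X\mid(Y,C)$ (the received information is predictively sufficient); (ii) the receiver-side Bayes state $S_Y$ is realizable by $\mathcal V$; (iii) $Q_\theta$ attains the family optimum.
   Context: All random elements take values in standard Borel spaces; $\mathcal P(\mathcal F)$ is the space of probability measures on $\mathcal F$ with its evaluation $\sigma$-field, and the report class $\mathcal Q\subseteq\mathcal P(\mathcal F)$ carries the trace $\sigma$-field. The loss $L$ is measurable. $F-(X,C)-Y$ means that $F$ and $Y$ are conditionally independent given $(X,C)$. $S_X=P_{F\mid X,C}(\cdot\mid X,C)$ and $S_Y=P_{F\mid Y,C}(\cdot\mid Y,C)$ are the conditional laws of $F$ given $(X,C)$ and given $(Y,C)$. For $P,Q\in\mathcal Q$: $R_L(P,Q)\triangleq\mathbb E_{F\sim P}[L(Q,F)]$. $L$ is *proper* on $\mathcal Q$ if $R_L(P,P)\le R_L(P,Q)$ for all $P,Q\in\mathcal Q$, and *strictly proper* if moreover equality holds only when $Q=P$. $H_L(P)\triangleq R_L(P,P)$; whenever the difference is well defined, $D_L(P\|Q)\triangleq R_L(P,Q)-R_L(P,P)$. For $U\in\{X,Y\}$, $H_L(F\mid U,C)\triangleq\mathbb E[H_L(S_U)]$. $\mathcal V$ consists of measurable kernels $Q:(y,c)\mapsto Q(\cdot\mid y,c)\in\mathcal Q$. For $Q\in\mathcal V$, $\mathcal R_L(Q)\triangleq\mathbb E[L(Q(\cdot\mid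 Y,C),F)]$, and $H_{L,\mathcal V}(F\mid Y,C)\triangleq\inf_{Q\in\mathcal V}\mathcal R_L(Q)$. The gaps are $\Delta_{\rm comm}\triangleq H_L(F\mid Y,C)-H_L(F\mid X,C)$, $\Delta_{\rm family}^{\mathcal V}\triangleq H_{L,\mathcal V}(F\mid Y,C)-H_L(F\mid Y,C)$, $\Delta_{\rm deploy}^{\theta}\triangleq\mathcal R_L(Q_\theta)-H_{L,\mathcal V}(F\mid Y,C)$. *)

(* Defs.v *)
From HB Require Import structures.
From mathcomp Require Import all_boot all_order all_algebra.
From mathcomp Require Import all_classical all_reals all_analysis.
From mathcomp Require Import measurable_realfun.

Set Implicit Arguments.
Unset Strict Implicit.
Unset Printing Implicit Defensive.

Import Order.TTheory GRing.Theory Num.Theory.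
Import numFieldNormedType.Exports.

Local Open Scope classical_set_scope.
Local Open Scope ring_scope.
Local Open Scope ereal_scope.

(* Conventions.
   - All expectations are library integrals of \bar R-valued functions, i.e.
     the difference of the integrals of the positive and negative parts, with
     +oo - +oo = -oo. Hence an ill-defined integral is never finite, and a
     finite infimum of integrals excludes ill-defined ones.
   - Random predictive measures are a.s. in the report class, so a loss
     evaluated at them is specified, and agrees with a measurable function, off
     a null set; the integral does not depend on the values on null sets.
   - The measurable space of probability measures is the library's
     [pprobability T R], with the sigma-algebra generated by the evaluations at
     measurable sets; a measurable map into it is a probability kernel. *)

Definition standard_borel (R : realType) (d : measure_display)
    (T : measurableType d) : Prop :=
  exists (M : completePseudoMetricType R) (f : T -> M),
    [/\ hausdorff_space M,
        @second_countable M,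
        bijective f &
        forall A : set T,
          measurable A <-> <<s [set U : set M | open U] >> (f @` A)].

(* Elements of [probability T R] are functions on all sets, with unconstrained
   values on the non-measurable ones; equality of measures is thus equality on
   measurable sets and not Leibniz equality. *)
Definition same_law (R : realType) (d : measure_display)
    (T : measurableType d) (p q : probability T R) : Prop :=
  forall B : set T, measurable B -> p B = q B.

Section conditioning.
Context (R : realType) (d : measure_display) (Omega : measurableType d).
Variable P : probability Omega R.

Definition is_cond_prob (dW : measure_display) (TW : measurableType dW)
    (W : Omega -> TW) (E : set Omega) (g : TW -> \bar R) : Prop :=
  measurable_fun [set: TW] g /\
  forall D : set TW, measurable D ->
    \int[P]_(w in W @^-1` D) g (W w) = P (E `&` W @^-1` D).

Definition is_cond_law (dF dW : measure_display) (TF : measurableType dF)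
    (TW : measurableType dW) (F : Omega -> TF) (W : Omega -> TW)
    (S : TW -> pprobability TF R) : Prop :=
  forall B : set TF, measurable B ->
    is_cond_prob W (F @^-1` B) (fun t => (S t : probability TF R) B).

(* Versions of conditional probabilities exist and are a.s. unique, so asking
   for some versions or for all versions is the same. *)
Definition cond_indep (dU dV dW : measure_display) (TU : measurableType dU)
    (TV : measurableType dV) (TW : measurableType dW)
    (U : Omega -> TU) (V : Omega -> TV) (W : Omega -> TW) : Prop :=
  forall (A : set TU) (B : set TV), measurable A -> measurable B ->
    exists gU gV gUV : TW -> \bar R,
      [/\ is_cond_prob W (U @^-1` A) gU,
          is_cond_prob W (V @^-1` B) gV,
          is_cond_prob W (U @^-1` A `&` V @^-1` B) gUV &
          {ae P, forall w, gUV (W w) = gU (W w) * gV (W w)}].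

End conditioning.

Section losses.
Context (R : realType) (dF : measure_display) (TF : measurableType dF).

(* A loss on [Q] is given by a total function whose values outside [Q] are
   irrelevant. *)
Implicit Types (L : pprobability TF R -> TF -> \bar R)
  (Q : set (pprobability TF R)) (p q : pprobability TF R).

(* [Q] carries the trace sigma-algebra and need not be measurable, whereas
   [measurable_fun D f] is vacuous for a non-measurable [D]. *)
Definition measurable_loss Q L : Prop :=
  forall B : set (\bar R), measurable B ->
    strace measurable (Q `*` [set: TF])
      ((Q `*` [set: TF]) `&` [set z | B (L z.1 z.2)]).

Definition expected_loss L p q : \bar R :=
  \int[(p : probability TF R)]_f L q f.

Definition proper_loss Q L : Prop :=
  forall p q, Q p -> Q q -> expected_loss L p p <= expected_loss L p q.

Definition strictly_proper_loss Q L : Prop :=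
  proper_loss Q L /\
  forall p q, Q p -> Q q -> expected_loss L p q = expected_loss L p p ->
    same_law q p.

Definition bayes_loss L p : \bar R := expected_loss L p p.

Definition divergence L p q : \bar R :=
  expected_loss L p q - expected_loss L p p.

Context (d dW : measure_display) (Omega : measurableType d)
  (TW : measurableType dW).
Variable P : probability Omega R.

Definition cond_entropy L (W : Omega -> TW) (S : TW -> pprobability TF R) :
    \bar R :=
  \int[P]_w bayes_loss L (S (W w)).

Definition risk L (F : Omega -> TF) (W : Omega -> TW)
    (q : TW -> pprobability TF R) : \bar R :=
  \int[P]_w L (q (W w)) (F w).

Definition family_entropy L (F : Omega -> TF) (W : Omega -> TW)
    (V : set {mfun TW >-> pprobability TF R}) : \bar R :=
  ereal_inf [set risk L F W q | q in V].

Definition risk_argmin L (F : Omega -> TF) (W : Omega -> TW)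
    (V : set {mfun TW >-> pprobability TF R}) :
    set {mfun TW >-> pprobability TF R} :=
  [set q | V q /\
    forall q' : {mfun TW >-> pprobability TF R},
      V q' -> risk L F W q <= risk L F W q'].

End losses.

(* Main.v *)
Require Import Defs.
From HB Require Import structures.
From mathcomp Require Import all_boot all_order all_algebra.
From mathcomp Require Import all_classical all_reals all_analysis.
From mathcomp Require Import measurable_realfun.

Set Implicit Arguments.
Unset Strict Implicit.
Unset Printing Implicit Defensive.

Import Order.TTheory GRing.Theory Num.Theory.
Import numFieldNormedType.Exports.

Local Open Scope classical_set_scope.
Local Open Scope ring_scope.
Local Open Scope ereal_scope.

(** For a report q that is a function of (Y,C), the risk of q is the mean of
    R_L(S_Y, q(Y,C)), and by the Markov property S_X is also a conditional law
    of F given (X,Y,C), so that S_X and S_Y give the same means to losses that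
    depend on (Y,C) and F only. Hence E D_L(S_X || q) is the mean of R_L(S_Y, q)
    minus H_L(F|X,C), and it is nonnegative by properness. Taking q = Q_theta and
    q = S_Y, and replacing S_X by S_Y, identifies the gaps with expected
    divergences: each is nonnegative, they add up to R_L(Q_theta) - H_L(F|X,C),
    and under strict properness each expected divergence vanishes only if the
    report equals the state.
    If F and X are independent given (Y,C), then S_Y is also a conditional law of
    F given (X,Y,C), and exchanging the roles of S_X and S_Y gives
    H_L(F|Y,C) <= H_L(F|X,C). *)

(** * Integrals and null sets *)

Section ae_integral.
Context (R : realType) (d : measure_display) (T : measurableType d).
Variable mu : {measure set T -> \bar R}.

Import HBNNSimple.

(* The integral of a nonnegative function is a supremum over simple functions
   below it, so that null sets are irrelevant even without measurability. *)
Lemma ge0_ae_le_integral (f g : T -> \bar R) :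
  (forall x, 0 <= f x) -> (forall x, 0 <= g x) ->
  {ae mu, forall x, f x = g x} -> \int[mu]_x f x <= \int[mu]_x g x.
Proof.
move=> f0 g0 [N [mN N0 fgN]].
rewrite [leLHS]ge0_integralTE//.
apply: ge_ereal_sup => _ [h hf <-].
have mCN : measurable (~` N) by exact: measurableC.
(* Setting [h] to zero on the null set [N] keeps its integral and leaves a simple function that lies
   below [g] everywhere. *)
rewrite -integralT_nnsfun (@ge0_negligible_integral _ _ _ _ _ N)//; last 2 first.
- by apply/measurable_EFinP.
- by move=> x _; rewrite lee_fin.
rewrite setTD.
have -> : \int[mu]_(x in ~` N) (h x)%:E =
    \int[mu]_x ((proj_nnsfun h mCN) x)%:E.
  rewrite integral_mkcond; apply: eq_integral => x _.
  by rewrite patchE/= mindicE; case: ifPn => _; rewrite ?mulr1 ?mulr0.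
rewrite integralT_nnsfun [leRHS]ge0_integralTE//.
apply: ereal_sup_ubound; exists (proj_nnsfun h mCN) => //= x.
rewrite mindicE; case: (boolP (x \in _)) => [|_]; last by rewrite mulr0.
rewrite inE => /= Nx; rewrite mulr1.
by rewrite -(contra_notP (fgN x) Nx).
Qed.

Lemma ae_eq_integralT (f g : T -> \bar R) :
  {ae mu, forall x, f x = g x} -> \int[mu]_x f x = \int[mu]_x g x.
Proof.
move=> fg; rewrite [LHS]integralE [RHS]integralE; congr (_ - _);
  apply/eqP; rewrite eq_le; apply/andP; split; apply: ge0_ae_le_integral => //;
    by apply: filterS fg => x fgx; rewrite ?funeposE ?funenegE fgx.
Qed.

End ae_integral.

(** * Extension of a loss off the report class *)

Lemma ereal_dense_rat (R : realType) (x y : \bar R) :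
  x < y -> exists q : rat, x < (ratr q : R)%:E < y.
Proof.
have rat_between (a b : R) : (a < b)%R ->
    exists q : rat, a%:E < (ratr q : R)%:E < b%:E.
  by move=> /rat_in_itvoo[q]; rewrite in_itv/= => aqb; exists q; rewrite !lte_fin.
move: x y => [a| |] [b| |] //; rewrite ?lte_fin => xy.
- exact: rat_between.
- have [|q /andP[aq _]] := rat_between a (a + 1)%R; first by rewrite ltrDl.
  by exists q; rewrite aq ltry.
- have [|q /andP[_ qb]] := rat_between (b - 1)%R b.
    by rewrite ltrBlDr ltrDl.
  by exists q; rewrite qb ltNyr.
- by exists 0%R; rewrite ltNyr ltry.
Qed.

Section trace_extension.
Context (R : realType) (d : measure_display) (T : measurableType d).

(** Each sublevel set of [f] at a rational [q] is the trace on [D] of a measurable set [E q]. The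
    infimum of the rationals [q] with [z] in [E q] is defined for every [z]; its strict sublevel
    sets are countable unions of sets [E q], and on [D] density of the rationals gives back [f]. *)
Lemma trace_measurable_extension (D : set T) (f : T -> \bar R) :
  (forall B : set (\bar R), measurable B ->
     strace measurable D (D `&` [set z | B (f z)])) ->
  exists g : T -> \bar R,
    measurable_fun [set: T] g /\ forall z, D z -> g z = f z.
Proof.
move=> hf.
have /choice[E hE] (q : rat) : exists A : set T,
    measurable A /\ A `&` D = D `&` [set z | f z < (ratr q : R)%:E].
  have [A mA AD] := hf _ (emeasurable_itv `]-oo, (ratr q : R)%:E[).
  exists A; split => //; rewrite AD; apply/seteqP; split => z /= [Dz];
    by rewrite /= in_itv/=.
pose g z := ereal_inf [set (ratr q : R)%:E | q in [set q | E q z]].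
exists g; split.
  apply: (measurability _ (ErealGenInftyO.measurableE R)) => _ /= -[_ [r ->] <-].
  rewrite setTI preimage_itvNyo.
  have -> : [set x | g x < r%:E] =
      \bigcup_(q in [set q : rat | (ratr q < r)%R]) E q.
    apply/seteqP; split => z /=.
      move=> /ereal_inf_lt[_ [q Eq <-]]; rewrite lte_fin => qr.
      by exists q.
    move=> [q /= qr Eq]; apply: le_lt_trans (_ : (ratr q)%:E < _).
      by apply: ereal_inf_lbound; exists q.
    by rewrite lte_fin.
  rewrite bigcup_mkcond; apply: bigcupT_measurable_rat => q.
  by case: ifP => // _; exact: (hE q).1.
move=> z Dz.
have Ef q : E q z <-> f z < (ratr q : R)%:E.
  have [_ /seteqP[h1 h2]] := hE q; split.
    by move=> Eqz; have [] := h1 z (conj Eqz Dz).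
  by move=> fq; have [] := h2 z (conj Dz fq).
apply/eqP; rewrite eq_le; apply/andP; split; last first.
  by apply: le_ereal_inf_tmp => _ [q /= /Ef fq <-]; exact: ltW.
rewrite leNgt; apply/negP => fg.
have [q /andP[fq qg]] : exists q : rat, f z < (ratr q : R)%:E < g z.
  exact: ereal_dense_rat.
have : g z <= (ratr q)%:E.
  by apply: ereal_inf_lbound; exists q => //; apply/Ef.
by rewrite leNgt qg.
Qed.

End trace_extension.

(** * Measurable maps do not separate equal laws *)

Section same_law_invariance.
Context (R : realType) (dF : measure_display) (TF : measurableType dF).

(** The sets that contain both or neither of [p] and [q] form a sigma-algebra, and it contains the
    evaluation preimages that generate the measurable sets. *)
Lemma same_law_measurable (p q : pprobability TF R)
    (A : set (pprobability TF R)) :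
  same_law p q -> measurable A -> (A p <-> A q).
Proof.
move=> pq; have : @measurable _ (pprobability TF R) `<=` [set A | A p <-> A q].
  rewrite /measurable/=; apply: smallest_sub; first (split => /=; first by []).
  - by move=> B Bpq; split => -[_ nB]; split => // ?; apply: nB; apply/Bpq.
  - move=> B Bpq; split => -[k _ Bk]; exists k => //; exact/Bpq.
  - by move=> _ [r _] [U mU] <- /=; rewrite /mset/= (pq _ mU).
by move=> sub mA; exact: sub mA.
Qed.

Lemma same_law_measurable_fun
    (f : pprobability TF R * TF -> \bar R) (p q : pprobability TF R) (x : TF) :
  measurable_fun [set: pprobability TF R * TF] f ->
  same_law p q -> f (p, x) = f (q, x).
Proof.
move=> mf pq.
have mfx : measurable_fun [set: pprobability TF R] (fun p => f (p, x)).
  by apply: measurableT_comp mf _; exact: pair2_measurable.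
(* The level set of [f (p, x)] is a measurable set that contains [p], hence also [q]. *)
have mfp : measurable ((fun p => f (p, x)) @^-1` [set f (p, x)]).
  by rewrite -[X in measurable X]setTI; apply: mfx => //; exact: emeasurable_set1.
by have [/(_ erefl)] := same_law_measurable pq mfp.
Qed.

End same_law_invariance.

(** * Disintegrations *)

Section density.
Context (R : realType) (d : measure_display) (T : measurableType d).
Variables (mu : {measure set T -> \bar R}) (f : T -> \bar R).

(** The measure with density [f] with respect to [mu]. The proofs are arguments so that the measure
    structure can be attached to the term. *)
Definition density (mf : measurable_fun [set: T] f)
  (f0 : forall x, 0 <= f x) (A : set T) : \bar R := \int[mu]_(x in A) f x.

Hypotheses (mf : measurable_fun [set: T] f) (f0 : forall x, 0 <= f x).

Let density0 : density mf f0 set0 = 0.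
Proof. exact: integral_set0. Qed.

Let density_ge0 A : 0 <= density mf f0 A.
Proof. exact: integral_ge0. Qed.

Let density_sigma_additive : semi_sigma_additive (density mf f0).
Proof.
move=> F mF tF mUF; rewrite /density ge0_integral_bigcup//; last first.
  exact: measurable_funTS.
by apply: is_cvg_ereal_nneg_natsum_cond => n _ _; exact: integral_ge0.
Qed.

HB.instance Definition _ := isMeasure.Build _ _ _ (density mf f0)
  density0 density_ge0 density_sigma_additive.

End density.

Section disintegration.
Context (R : realType) (d dF : measure_display) (Omega : measurableType d)
  (TF : measurableType dF).
Variable P : probability Omega R.

(* [S] is a version of the conditional law of [F] given [G], not required to be
   a function of [G]. *)
Definition disintegrates dG (TG : measurableType dG) (G : Omega -> TG)
    (F : Omega -> TF) (S : Omega -> pprobability TF R) : Prop :=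
  forall (D : set TG) (B : set TF), measurable D -> measurable B ->
    \int[P]_(w in G @^-1` D) (S w : probability TF R) B =
      P (F @^-1` B `&` G @^-1` D).

(** Conditioning can be coarsened with [S] kept unchanged, because [S] need not be a function of the
    conditioning variable. This is how a conditional law given (X,Y,C) is used given (Y,C) or
    (X,C). *)
Lemma disintegrates_comp dG dH (TG : measurableType dG)
    (TH : measurableType dH) (G : Omega -> TG) (h : TG -> TH)
    (F : Omega -> TF) (S : Omega -> pprobability TF R) :
  measurable_fun [set: TG] h ->
  disintegrates G F S -> disintegrates (h \o G) F S.
Proof.
move=> mh GFS D B mD mB; apply: (GFS (h @^-1` D)) => //.
by rewrite -[X in measurable X]setTI; exact: mh.
Qed.

Lemma measurable_eval (S : Omega -> pprobability TF R) (B : set TF) :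
  measurable_fun [set: Omega] S -> measurable B ->
  measurable_fun [set: Omega] (fun w => (S w : probability TF R) B).
Proof.
by move=> mS mB; exact: (measurable_kernel (kprobability mS) B mB).
Qed.

Lemma measurable_expectation (S : Omega -> pprobability TF R)
    (phi : Omega * TF -> \bar R) :
  measurable_fun [set: Omega] S -> measurable_fun [set: Omega * TF] phi ->
  measurable_fun [set: Omega]
    (fun w => \int[S w : probability TF R]_f phi (w, f)).
Proof.
move=> mS mphi.
have -> : (fun w => \int[S w : probability TF R]_f phi (w, f)) = (fun w =>
    \int[S w : probability TF R]_f phi^\+ (w, f) -
    \int[S w : probability TF R]_f phi^\- (w, f)).
  apply/funext => w; rewrite integralE; congr (_ - _);
    by apply: eq_integral => f _; rewrite ?funeposE ?funenegE.
apply: emeasurable_funB;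
  apply: (measurable_fun_integral_sfinite_kernel _ (kprobability mS)) => //.
- exact: measurable_funepos.
- exact: measurable_funeneg.
Qed.

(** Both sides integrate [phi] on the product space: the left one against the law of [(G, F)], the
    right one against the law of [(G w, f)] with [w] drawn from [P] and [f] from [S w]. On
    rectangles the two laws agree by the disintegration property, and rectangles are a generating
    pi-system. *)
Lemma disintegrates_integral dG (TG : measurableType dG) (G : Omega -> TG)
    (F : Omega -> TF) (S : Omega -> pprobability TF R)
    (phi : TG * TF -> \bar R) :
  measurable_fun [set: Omega] G -> measurable_fun [set: Omega] F ->
  measurable_fun [set: Omega] S -> disintegrates G F S ->
  (forall z, 0 <= phi z) -> measurable_fun [set: TG * TF] phi ->
  \int[P]_w phi (G w, F w) =
    \int[P]_w \int[S w : probability TF R]_f phi (G w, f).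
Proof.
move=> mG mF mS GFS phi0 mphi.
have mGF : measurable_fun [set: Omega] (fun w => (G w, F w)).
  exact/measurable_fun_pair.
have mS2 : measurable_fun [set: unit * Omega] (S \o snd).
  by apply: measurableT_comp.
have mG2 : measurable_fun [set: (unit * Omega) * TF]
    (fun z => (G z.1.2, z.2)).
  apply/measurable_fun_pair => //.
  by apply: measurableT_comp => //; apply: measurableT_comp.
(* [P] is viewed as a kernel from a one-point space, so that the second law is the composite kernel
   [mkcomp l k] at [tt]. *)
pose l : R.-sfker unit ~> Omega := kprobability
  (@measurable_cst _ _ unit (pprobability Omega R) setT P).
pose k : R.-sfker (unit * Omega) ~> (TG * TF)%type :=
  (kprobability mS2 \; kdirac mG2).
have intE (f : TG * TF -> \bar R) : (forall z, 0 <= f z) ->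
    measurable_fun [set: TG * TF] f ->
    \int[mkcomp l k tt]_z f z =
    \int[P]_w \int[S w : probability TF R]_y f (G w, y).
  move=> f0 mf; rewrite /mkcomp integral_kcomp//; apply: eq_integral => w _.
  rewrite /k/= /mkcomp integral_kcomp//=; apply: eq_integral => y _.
  by rewrite integral_dirac// diracT mul1e.
rewrite -intE//.
rewrite -[LHS](@ge0_integral_pushforward _ _ _ _ _ _ mGF P setT phi)//.
apply: eq_measure_integral => A mA _.
pose rect := [set D `*` B | D in @measurable _ TG & B in @measurable _ TF].
apply: (measure_unique rect (fun=> setT)) => //.
- exact: measurable_prod_measurableType.
- move=> _ _ [D1 mD1 [B1 mB1 <-]] [D2 mD2 [B2 mB2 <-]].
  rewrite -setXI; exists (D1 `&` D2); first exact: measurableI.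
  by exists (B1 `&` B2); first exact: measurableI.
- by move=> _; exists setT => //; exists setT => //; rewrite setXTT.
- by rewrite bigcup_const//; exists 0%N.
- move=> _ [D mD [B mB <-]].
  have mDB : measurable (D `*` B) by exact: measurableX.
  have -> : mkcomp l k tt (D `*` B) =
      \int[mkcomp l k tt]_z (\1_(D `*` B) z)%:E.
    by rewrite integral_indic// setIT.
  rewrite intE//; last by apply/measurable_EFinP.
  transitivity (P (F @^-1` B `&` G @^-1` D)).
    by congr (P _); apply/seteqP; split => w /= [].
  rewrite -GFS// integral_mkcond; apply: eq_integral => w _.
  rewrite patchE; case: ifPn => [|]; rewrite (inE, notin_setE) /= => GwD.
    have -> : (S w : probability TF R) B =
        \int[S w : probability TF R]_f (\1_B f)%:E.
      by rewrite integral_indic// setIT.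
    apply: eq_integral => y _.
    rewrite !indicE; suff -> : ((G w, y) \in D `*` B) = (y \in B) by [].
    by apply/idP/idP; rewrite !inE/=; tauto.
  rewrite integral0_eq// => y _; rewrite indicE memNset// => -[].
  by move=> /GwD.
- move=> _; rewrite /pushforward.
  by apply: le_lt_trans (probability_le1 P _) (ltry _); exact: measurableT.
Qed.

(** For fixed [B], both sides are finite measures of [D]: the images under [(V, W)] of the measure
    with density [S w B] and of [P] restricted to the event that [F] is in [B]. Agreement on
    rectangles therefore suffices. *)
Lemma disintegrates_pair dV dW (TV : measurableType dV)
    (TW : measurableType dW) (V : Omega -> TV) (W : Omega -> TW)
    (F : Omega -> TF) (S : Omega -> pprobability TF R) :
  measurable_fun [set: Omega] V -> measurable_fun [set: Omega] W ->
  measurable_fun [set: Omega] F -> measurable_fun [set: Omega] S ->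
  (forall A D B, measurable A -> measurable D -> measurable B ->
     \int[P]_(w in V @^-1` A `&` W @^-1` D) (S w : probability TF R) B =
       P (F @^-1` B `&` (V @^-1` A `&` W @^-1` D))) ->
  disintegrates (fun w => (V w, W w)) F S.
Proof.
move=> mV mW mF mS rectE D B mD mB.
have mG : measurable_fun [set: Omega] (fun w => (V w, W w)).
  exact/measurable_fun_pair.
have mFB : measurable (F @^-1` B) by rewrite -[X in measurable X]setTI; exact: mF.
have SB0 w : 0 <= (S w : probability TF R) B by [].
pose m1 : {measure set Omega -> \bar R} := density P (measurable_eval mS mB) SB0.
pose m2 : {measure set Omega -> \bar R} := mrestr P mFB.
pose G w := (V w, W w).
suff : pushforward m1 G D = pushforward m2 G D.
  by move=> e; rewrite [in RHS]setIC; exact: e.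
pose rect := [set A `*` C | A in @measurable _ TV & C in @measurable _ TW].
apply: (measure_unique rect (fun=> setT)) => //.
- exact: measurable_prod_measurableType.
- move=> _ _ [D1 mD1 [B1 mB1 <-]] [D2 mD2 [B2 mB2 <-]].
  rewrite -setXI; exists (D1 `&` D2); first exact: measurableI.
  by exists (B1 `&` B2); first exact: measurableI.
- by move=> _; exists setT => //; exists setT => //; rewrite setXTT.
- by rewrite bigcup_const//; exists 0%N.
- move=> _ [A mA [C mC <-]].
  change (\int[P]_(w in V @^-1` A `&` W @^-1` C) (S w : probability TF R) B =
          P (V @^-1` A `&` W @^-1` C `&` F @^-1` B)).
  by rewrite [in RHS]setIC rectE.
- move=> _; change (\int[P]_w (S w : probability TF R) B < +oo).
  apply: (@le_lt_trans _ _ (\int[P]_(x in [set: Omega]) cst 1 x)).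
    apply: ge0_le_integral => //.
    - exact: measurable_eval.
    - by move=> w _; exact: probability_le1.
  rewrite integral_cst// mul1e.
  by apply: le_lt_trans (probability_le1 P _) (ltry _).
Qed.

End disintegration.

(** * Finite integrals and exhaustion *)

Section finite_integral.
Context (R : realType) (d : measure_display) (T : measurableType d).
Variable mu : {measure set T -> \bar R}.

(** A finite difference forces both terms to be finite, hence also the integral of the absolute
    value, which is their sum. *)
Lemma fin_num_integrable (f : T -> \bar R) :
  measurable_fun [set: T] f -> \int[mu]_x f x \is a fin_num ->
  mu.-integrable [set: T] f.
Proof.
move=> mf; rewrite integralE fin_numB => /andP[fp fn].
apply/integrableP; split => //.
under eq_integral do rewrite -/((abse \o f) _) fune_abse.
rewrite ge0_integralD//; last 2 first.
- exact: measurable_funepos.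
- exact: measurable_funeneg.
by rewrite lte_add_pinfty// ltey_eq ?fp ?fn.
Qed.

(** Monotone convergence along [B], whose union has full measure. *)
Lemma ge0_eq_integral_exhaustion (B : (set T)^nat) (f g : T -> \bar R) :
  nondecreasing_seq B -> (forall n, measurable (B n)) ->
  {ae mu, forall x, (\bigcup_n B n) x} ->
  (forall x, 0 <= f x) -> measurable_fun [set: T] f ->
  (forall x, 0 <= g x) -> measurable_fun [set: T] g ->
  (forall n, \int[mu]_(x in B n) f x = \int[mu]_(x in B n) g x) ->
  \int[mu]_x f x = \int[mu]_x g x.
Proof.
move=> ndB mB Bae f0 mf g0 mg fg.
have mU : measurable (\bigcup_n B n) by exact: bigcupT_measurable.
have full (h : T -> \bar R) : (forall x, 0 <= h x) ->
    measurable_fun [set: T] h ->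
    \int[mu]_x h x = \int[mu]_(x in \bigcup_n B n) h x.
  move=> h0 mh; rewrite (@ge0_negligible_integral _ _ _ _ _ (~` (\bigcup_n B n)))//.
  - by rewrite setTD setCK.
  - exact: measurableC.
  - have [N [mN N0 sub]] := Bae.
    by apply: subset_measure0 N0 => //; exact: measurableC.
rewrite !full//.
have cvg (h : T -> \bar R) : (forall x, 0 <= h x) ->
    measurable_fun [set: T] h ->
    \int[mu]_(x in B i) h x @[i --> \oo] --> \int[mu]_(x in \bigcup_n B n) h x.
  move=> h0 mh; apply: ge0_nondecreasing_set_cvg_integral => //.
  by move=> i; exact: measurable_funTS.
have := cvg f f0 mf; rewrite (_ : (fun i => _) = fun i => \int[mu]_(x in B i) g x).
  by move=> cf; apply: (cvg_unique _ cf) => //; exact: cvg.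
by apply/funext => n; exact: fg.
Qed.

End finite_integral.

(** * Expectations under a disintegration *)

Section disintegration_expectation.
Context (R : realType) (d dF dW : measure_display) (Omega : measurableType d)
  (TF : measurableType dF) (TW : measurableType dW).
Variable P : probability Omega R.
Variables (F : Omega -> TF) (W : Omega -> TW).
Hypothesis mF : measurable_fun [set: Omega] F.
Hypothesis mW : measurable_fun [set: Omega] W.

Let expect (S : Omega -> pprobability TF R) (phi : TW * TF -> \bar R) w :=
  \int[S w : probability TF R]_f phi (W w, f).

Let expect_posneg S phi w :
  expect S phi w = expect S phi^\+ w - expect S phi^\- w.
Proof.
rewrite /expect integralE; congr (_ - _);
  by apply: eq_integral => f _; rewrite ?funeposE ?funenegE.
Qed.

Lemma measurable_expectation_comp (S : Omega -> pprobability TF R)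
    (phi : TW * TF -> \bar R) :
  measurable_fun [set: Omega] S -> measurable_fun [set: TW * TF] phi ->
  measurable_fun [set: Omega]
    (fun w => \int[S w : probability TF R]_f phi (W w, f)).
Proof.
move=> mS mphi.
apply: (measurable_expectation (phi := fun z => phi (W z.1, z.2))) => //.
apply: measurableT_comp => //; apply/measurable_fun_pair => //.
exact: measurableT_comp.
Qed.

(** The indicator of [D] is absorbed into the integrand, which reduces the claim to an integral over
    the whole space. *)
Lemma disintegrates_integral_set (S : Omega -> pprobability TF R)
    (phi : TW * TF -> \bar R) (D : set TW) :
  measurable_fun [set: Omega] S -> disintegrates P W F S ->
  (forall z, 0 <= phi z) -> measurable_fun [set: TW * TF] phi ->
  measurable D ->
  \int[P]_(w in W @^-1` D) phi (W w, F w) =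
    \int[P]_(w in W @^-1` D) \int[S w : probability TF R]_f phi (W w, f).
Proof.
move=> mS dS phi0 mphi mD.
pose psi (z : TW * TF) := (\1_(D `*` [set: TF]) z)%:E * phi z.
have psi0 z : 0 <= psi z by rewrite mule_ge0// lee_fin.
have mpsi : measurable_fun [set: TW * TF] psi.
  apply: emeasurable_funM => //; apply/measurable_EFinP.
  by apply: measurable_indic; exact: measurableX.
have psiE w f : psi (W w, f) = if w \in W @^-1` D then phi (W w, f) else 0.
  rewrite /psi indicE; case: ifPn => wD.
    by rewrite mem_set ?mul1e//; split => //; move: wD; rewrite inE.
  by rewrite memNset ?mul0e// => -[wD' _]; move/negP: wD; rewrite inE.
transitivity (\int[P]_w psi (W w, F w)).
  rewrite integral_mkcond; apply: eq_integral => w _.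
  by rewrite patchE psiE.
rewrite (disintegrates_integral mW mF mS dS psi0 mpsi) [RHS]integral_mkcond.
apply: eq_integral => w _; rewrite patchE.
under eq_integral do rewrite psiE.
by case: ifPn => // _; rewrite integral0.
Qed.

(** The nonnegative case applies to the positive and negative parts of [phi]. Finiteness of the
    left-hand side makes both resulting integrals finite, so that they can be subtracted under one
    integral sign. *)
Lemma disintegrates_fin_integral (S : Omega -> pprobability TF R)
    (phi : TW * TF -> \bar R) :
  measurable_fun [set: Omega] S -> disintegrates P W F S ->
  measurable_fun [set: TW * TF] phi ->
  \int[P]_w phi (W w, F w) \is a fin_num ->
  \int[P]_w phi (W w, F w) =
    \int[P]_w \int[S w : probability TF R]_f phi (W w, f).
Proof.
move=> mS dS mphi; rewrite integralE.
have -> : \int[P]_w (fun w => phi (W w, F w))^\+ w =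
    \int[P]_w expect S phi^\+ w.
  rewrite -(disintegrates_integral mW mF mS dS)//; last exact: measurable_funepos.
  by apply: eq_integral => w _; rewrite !funeposE.
have -> : \int[P]_w (fun w => phi (W w, F w))^\- w =
    \int[P]_w expect S phi^\- w.
  rewrite -(disintegrates_integral mW mF mS dS)//; last exact: measurable_funeneg.
  by apply: eq_integral => w _; rewrite !funenegE.
rewrite fin_numB => /andP[fp fn].
rewrite -integralB//.
- by apply: eq_integral => w _; rewrite -expect_posneg.
- apply: fin_num_integrable => //; apply: measurable_expectation_comp => //.
  exact: measurable_funepos.
- apply: fin_num_integrable => //; apply: measurable_expectation_comp => //.
  exact: measurable_funeneg.
Qed.

(* [phi (W, F)] need not be integrable: its conditional expectation given [W]
   may be integrable while that of its absolute value is only finite. Hence the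
   localization to the events where the latter is at most [n]. *)
Lemma disintegrates_integral_gap (S1 : Omega -> pprobability TF R)
    (s2 : TW -> pprobability TF R) (phi : TW * TF -> \bar R)
    (H : Omega -> \bar R) :
  measurable_fun [set: Omega] S1 -> disintegrates P W F S1 ->
  measurable_fun [set: TW] s2 -> disintegrates P W F (s2 \o W) ->
  measurable_fun [set: TW * TF] phi ->
  \int[P]_w \int[s2 (W w) : probability TF R]_f phi (W w, f) \is a fin_num ->
  P.-integrable [set: Omega] H ->
  {ae P, forall w, H w <= \int[S1 w : probability TF R]_f phi (W w, f)} ->
  \int[P]_w (\int[S1 w : probability TF R]_f phi (W w, f) - H w) =
    \int[P]_w \int[s2 (W w) : probability TF R]_f phi (W w, f) -
    \int[P]_w H w.
Proof.
move=> mS1 dS1 ms2 dS2 mphi fin2 intH HE1.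
have mS2 : measurable_fun [set: Omega] (s2 \o W) by exact: measurableT_comp.
have mpos : measurable_fun [set: TW * TF] phi^\+ by exact: measurable_funepos.
have mneg : measurable_fun [set: TW * TF] phi^\- by exact: measurable_funeneg.
have int2 : P.-integrable [set: Omega] (expect (s2 \o W) phi).
  by apply: fin_num_integrable => //; exact: measurable_expectation_comp.
pose al t := \int[s2 t : probability TF R]_f phi^\+ (t, f).
pose be t := \int[s2 t : probability TF R]_f phi^\- (t, f).
have mal : measurable_fun [set: TW] al by exact: measurable_expectation.
have mbe : measurable_fun [set: TW] be by exact: measurable_expectation.
have al0 t : 0 <= al t by exact: integral_ge0.
have be0 t : 0 <= be t by exact: integral_ge0.
(* [al + be] is the conditional mean of the absolute value of [phi] under [s2]. It is a function of
   [W], so that the localizing events [B n] are events of [W]. *)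
pose A n := [set t | al t + be t <= n%:R%:E].
have mA n : measurable (A n).
  rewrite /A -[X in measurable X]setTI.
  apply: emeasurable_fun_infty_c => //.
  exact: emeasurable_funD.
pose B n := W @^-1` A n.
have mB n : measurable (B n) by rewrite /B -[X in measurable X]setTI; exact: mW.
have ndB : nondecreasing_seq B.
  move=> m n mn; apply/subsetPset => w; rewrite /B /A/= => /le_trans; apply.
  by rewrite lee_fin ler_nat.
have Bae : {ae P, forall w, (\bigcup_n B n) w}.
  have := integrable_ae measurableT int2.
  apply: filterS => w /(_ I); rewrite expect_posneg fin_numB => /andP[afin bfin].
  have abfin : al (W w) + be (W w) \is a fin_num by rewrite fin_numD afin bfin.
  exists (Num.bound (fine (al (W w) + be (W w)))) => //.
  by rewrite /B /A/= -[leLHS]fineK// lee_fin ltW// archi_boundP// fine_ge0// adde_ge0.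
have cut S : measurable_fun [set: Omega] S -> disintegrates P W F S ->
    forall n, P.-integrable (B n) (expect S phi) /\
      \int[P]_(w in B n) expect S phi w =
        \int[P]_(w in B n) phi^\+ (W w, F w) -
        \int[P]_(w in B n) phi^\- (W w, F w).
  move=> mS dS n.
  have bound psi : measurable_fun [set: TW * TF] psi -> (forall z, 0 <= psi z) ->
      (forall w, expect (s2 \o W) psi w <= al (W w) + be (W w)) ->
      P.-integrable (B n) (expect S psi).
    move=> mpsi psi0 hle.
    apply/integrableP; split.
      by apply: measurable_funTS; exact: measurable_expectation_comp.
    under eq_integral do rewrite gee0_abs ?integral_ge0//.
    (* The bound [n] is known for [s2] only. It is passed to [S] through the integral of
       [psi (W, F)] over [B n], which both disintegrations compute. *)
    rewrite -[ltLHS](disintegrates_integral_set mS dS psi0 mpsi (mA n)).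
    rewrite [ltLHS](disintegrates_integral_set mS2 dS2 psi0 mpsi (mA n)).
    apply: (@le_lt_trans _ _ (\int[P]_(w in B n) (cst n%:R%:E w))).
      apply: ge0_le_integral => //; first exact: mB.
      - by move=> w _; exact: integral_ge0.
      - by apply: measurable_funTS; exact: measurable_expectation_comp.
      - by move=> w Bw; exact: le_trans (hle w) Bw.
    rewrite integral_cst; last exact: mB.
    rewrite lte_mul_pinfty// ?lee_fin//.
    by apply: le_lt_trans (probability_le1 P _) (ltry _).
  have intp : P.-integrable (B n) (expect S phi^\+).
    by apply: bound => // w; rewrite leeDl.
  have intn : P.-integrable (B n) (expect S phi^\-).
    by apply: bound => // w; rewrite leeDr.
  have E : expect S phi = (expect S phi^\+ \- expect S phi^\-).
    by apply/funext => w; rewrite expect_posneg.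
  rewrite E; split; first exact: integrableB.
  rewrite integralB//.
  by rewrite !(disintegrates_integral_set mS dS).
pose g := (expect (s2 \o W) phi \- H).
pose D := (expect S1 phi \- H).
have mH : measurable_fun [set: Omega] H by exact: (measurable_int P).
have intg : P.-integrable [set: Omega] g by exact: integrableB.
have mg : measurable_fun [set: Omega] g by exact: (measurable_int P).
have mD : measurable_fun [set: Omega] D.
  by apply: emeasurable_funB => //; exact: measurable_expectation_comp.
have DgB n : \int[P]_(w in B n) D w = \int[P]_(w in B n) g w.
  have intHB : P.-integrable (B n) H by exact: integrableS intH.
  have [i1 e1] := cut _ mS1 dS1 n; have [i2 e2] := cut _ mS2 dS2 n.
  by rewrite [LHS](integralB (mB n) i1 intHB) [RHS](integralB (mB n) i2 intHB) e1 e2.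
have D0 : {ae P, forall w, D w = D^\+ w}.
  have := integrable_ae measurableT intH.
  apply: filterS2 HE1 => w HE /(_ I) Hfin; rewrite funeposE; apply/esym/max_idPl.
  by rewrite sube_ge0// Hfin.
have -> : \int[P]_w (\int[S1 w : probability TF R]_f phi (W w, f) - H w) =
    \int[P]_w D^\+ w.
  exact: ae_eq_integralT.
rewrite -[RHS](integralB measurableT int2 intH) -/g.
have mDp : measurable_fun [set: Omega] D^\+ by exact: measurable_funepos.
have mgp : measurable_fun [set: Omega] g^\+ by exact: measurable_funepos.
have mgn : measurable_fun [set: Omega] g^\- by exact: measurable_funeneg.
(* Integrability of [D] is not known yet. With the negative part of [g] moved to the left, both
   sides are nonnegative and the exhaustion applies; the finite integral of that part is then
   subtracted. *)
have : \int[P]_w (D^\+ w + g^\- w) = \int[P]_w g^\+ w.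
  apply: (ge0_eq_integral_exhaustion ndB mB Bae) => //.
  - by move=> w; rewrite adde_ge0.
  - exact: emeasurable_funD.
  move=> n; rewrite ge0_integralD//; last 2 first.
  - exact: measurable_funTS.
  - exact: measurable_funTS.
  have intgB : P.-integrable (B n) g by exact: integrableS intg.
  have -> : \int[P]_(w in B n) D^\+ w = \int[P]_(w in B n) D w.
    apply: ae_eq_integral => //; [exact: measurable_funTS..|].
    by apply: filterS D0 => w Dw _; rewrite -Dw.
  by rewrite DgB [X in X + _]integralE subeK// integrable_neg_fin_num.
rewrite ge0_integralD// => DgE.
by rewrite [RHS]integralE -DgE addeK// integrable_neg_fin_num.
Qed.

End disintegration_expectation.

(** * Conditional independence *)

Section cond_prob.
Context (R : realType) (d dW : measure_display) (Omega : measurableType d)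
  (TW : measurableType dW).
Variables (P : probability Omega R) (W : {mfun Omega >-> TW}).

Section restricted_image.
Variables (E : set Omega) (mE : measurable E).

(** The image under [W] of [P] restricted to [E]. It has a name of its own to carry the measure and
    finiteness structures used by the Radon-Nikodym derivative. *)
Definition restricted_image (D : set TW) : \bar R := P (W @^-1` D `&` E).

Let restr := pushforward (mrestr P mE) W.

Let restricted_image0 : restricted_image set0 = 0.
Proof. by rewrite /restricted_image preimage_set0 set0I measure0. Qed.

Let restricted_image_ge0 D : 0 <= restricted_image D.
Proof. exact: measure_ge0. Qed.

Let restricted_image_sigma_additive : semi_sigma_additive restricted_image.
Proof. exact: (@measure_semi_sigma_additive _ _ _ restr). Qed.

HB.instance Definition _ := isMeasure.Build _ _ _ restricted_image
  restricted_image0 restricted_image_ge0 restricted_image_sigma_additive.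

Let restricted_image_fin : fin_num_fun restricted_image.
Proof.
move=> D mD; apply: fin_num_measure; apply: measurableI => //.
exact: measurable_funPTI.
Qed.

HB.instance Definition _ := Measure_isFinite.Build _ _ _ restricted_image
  restricted_image_fin.

Lemma integral_restricted_image (u : TW -> \bar R) (D : set TW) :
  measurable_fun [set: TW] u -> (forall t, 0 <= u t) -> measurable D ->
  \int[restricted_image]_(t in D) u t = \int[P]_(w in W @^-1` D `&` E) u (W w).
Proof.
move=> mu u0 mD.
have mWD : measurable (W @^-1` D) by exact: measurable_funPTI.
have muW : measurable_fun [set: Omega] (u \o W) by exact: measurableT_comp.
rewrite (eq_measure_integral restr)//.
rewrite ge0_integral_pushforward//; last exact: measurable_funTS.
(* The complement of [E] is null for the restricted measure, which agrees with [P] on subsets of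
   [E]. *)
rewrite (@ge0_negligible_integral _ _ _ _ _ (~` E))//; last 4 first.
- exact: measurableC.
- exact: measurable_funTS.
- by move=> w _; exact: u0.
- by change (P (~` E `&` E) = 0); rewrite setICl measure0.
rewrite setDE setCK; apply: eq_measure_integral => A mA AE.
have AsubE : A `<=` E by move=> x /AE[].
by change (P (A `&` E) = P A); rewrite setIidl.
Qed.

(** [g] is the Radon-Nikodym derivative of the restricted image with respect to the law of [W]. The
    last clause lets a factor that depends on [W] be pulled out of the conditional probability. *)
Lemma cond_prob_exists : exists g : TW -> \bar R,
  [/\ forall t, 0 <= g t, is_cond_prob P W E g &
      forall (u : TW -> \bar R) (D : set TW),
        measurable_fun [set: TW] u -> (forall t, 0 <= u t) -> measurable D ->
        \int[P]_(w in W @^-1` D) (u (W w) * g (W w)) =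
          \int[P]_(w in W @^-1` D `&` E) u (W w)].
Proof.
have dom : restricted_image `<< distribution P W.
  apply/null_content_dominatesP => A mA PA0.
  have mWA : measurable (W @^-1` A) by exact: measurable_funPTI.
  apply: (@subset_measure0 _ _ _ P _ _ _ mWA _ PA0); last exact: subIsetl.
  exact: measurableI.
pose g := Radon_Nikodym_SigmaFinite.f restricted_image (distribution P W).
have g0 t : 0 <= g t by exact: Radon_Nikodym_SigmaFinite.f_ge0.
have mg : measurable_fun [set: TW] g.
  exact: (measurable_int _ (Radon_Nikodym_SigmaFinite.f_integrable dom)).
have gE u D : measurable_fun [set: TW] u -> (forall t, 0 <= u t) ->
    measurable D ->
    \int[P]_(w in W @^-1` D) (u (W w) * g (W w)) =
      \int[P]_(w in W @^-1` D `&` E) u (W w).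
  move=> mu u0 mD; rewrite -integral_restricted_image//.
  rewrite -(Radon_Nikodym_SigmaFinite.change_of_variables dom)//; last first.
    exact: measurable_funTS.
  rewrite [RHS]ge0_integral_pushforward//.
  - by apply: measurable_funTS; exact: emeasurable_funM.
  - by move=> t _; rewrite mule_ge0.
exists g; split => //; split => // D mD.
have mWD : measurable (W @^-1` D) by exact: measurable_funPTI.
have := gE (cst 1) D (measurable_cst _) (fun=> lee01) mD.
under eq_integral do rewrite mul1e.
move=> ->; rewrite integral_cst; last exact: measurableI.
by rewrite mul1e setIC.
Qed.

(** Both versions have the same finite integrals against the law of [W] over all measurable sets,
    hence agree off a null set of that law, which is pulled back along [W]. *)
Lemma cond_prob_unique (g1 g2 : TW -> \bar R) :
  is_cond_prob P W E g1 -> is_cond_prob P W E g2 ->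
  {ae P, forall w, g1 (W w) = g2 (W w)}.
Proof.
move=> g1P g2P.
have intW (g : TW -> \bar R) : is_cond_prob P W E g ->
    P.-integrable [set: Omega] (g \o W).
  move=> [mg gE]; apply: fin_num_integrable; first exact: measurableT_comp.
  have := gE _ measurableT; rewrite preimage_setT setIT => ->.
  exact: fin_num_measure.
have pushE (g : TW -> \bar R) D : is_cond_prob P W E g -> measurable D ->
    \int[distribution P W]_(t in D) g t = P (E `&` W @^-1` D).
  move=> gP mD; rewrite -gP.2//.
  rewrite [LHS]integral_pushforward//; first exact: gP.1.
  apply: (integrableS measurableT) => //; last exact: intW.
  exact: measurable_funPTI.
have int1 : (distribution P W).-integrable [set: TW] g1.
  by apply: integrable_pushforward => //; [exact: g1P.1|exact: intW].
have [N [mN N0 sub]] : ae_eq (distribution P W) [set: TW] g1 g2.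
  by apply: integral_ae_eq => //[|D _ mD]; [exact: g2P.1|rewrite !pushE].
exists (W @^-1` N); split => //; first exact: measurable_funPTI.
by move=> w /= /eqP g12; apply: sub => /= /(_ I)/eqP; rewrite (negbTE g12).
Qed.

End restricted_image.

Section cond_indep.
Context (dF dV : measure_display) (TF : measurableType dF)
  (TV : measurableType dV).
Variables (F : {mfun Omega >-> TF}) (V : {mfun Omega >-> TV})
  (S : {mfun TW >-> pprobability TF R}).
Hypothesis FWS : is_cond_law P F W S.

Let mSB (B : set TF) : measurable B ->
  measurable_fun [set: TW] (fun t => (S t : probability TF R) B).
Proof. by move=> mB; exact: measurable_eval. Qed.

(** By independence, the joint conditional probability is [S] at [B] times that of the event on [V];
    pulling out the factor [S] turns its integral into one of [S] over that event. Uniqueness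
    replaces the versions given by [cond_indep] with these. *)
Lemma cond_indep_disintegrates :
  cond_indep P F V W -> disintegrates P (fun w => (V w, W w)) F (S \o W).
Proof.
have mSW : measurable_fun [set: Omega] (S \o W) by exact: measurableT_comp.
move=> indep.
apply: (disintegrates_pair (measurable_funPT V) (measurable_funPT W)
  (measurable_funPT F) mSW).
move=> A D B mA mD mB.
have [gU [gV [gUV [gUP gVP gUVP gUVE]]]] := indep B A mB mA.
have [g [g0 gP gE]] := cond_prob_exists (measurable_funPTI V mA).
have mWD : measurable (W @^-1` D) by exact: measurable_funPTI.
rewrite (setIC (V @^-1` A)) -[LHS](gE _ _ (mSB mB) _ mD)//.
have -> : F @^-1` B `&` (W @^-1` D `&` V @^-1` A) =
    (F @^-1` B `&` V @^-1` A) `&` W @^-1` D by rewrite (setIC (W @^-1` D)) setIA.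
rewrite -gUVP.2//; apply: ae_eq_integral => //.
- apply: measurable_funTS.
  apply: (measurableT_comp (emeasurable_funM (mSB mB) gP.1)).
  exact: measurable_funPT.
- apply: measurable_funTS.
  exact: (measurableT_comp gUVP.1 (measurable_funPT W)).
have := cond_prob_unique (measurable_funPTI F mB) gUP (FWS mB).
have := cond_prob_unique (measurable_funPTI V mA) gVP gP.
apply: filterS3 gUVE => w guv gv gu _.
by rewrite guv gv gu.
Qed.

(** The same computation read backwards: the product of the two conditional probabilities is itself
    a version of the joint one. *)
Lemma disintegrates_cond_indep :
  disintegrates P (fun w => (V w, W w)) F (S \o W) -> cond_indep P F V W.
Proof.
move=> dS A B mA mB.
have [gV [gV0 gVP gVE]] := cond_prob_exists (measurable_funPTI V mB).
pose gU t := (S t : probability TF R) A.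
exists gU, gV, (fun t => gU t * gV t); split => //.
- exact: FWS.
- split; first by apply: emeasurable_funM; [exact: mSB|exact: gVP.1].
  move=> D mD; rewrite gVE//; last exact: mSB.
  have := dS (B `*` D) A (measurableX mB mD) mA.
  have -> : (fun w => (V w, W w)) @^-1` (B `*` D) = W @^-1` D `&` V @^-1` B.
    by rewrite setIC.
  by move=> e; rewrite [LHS]e (setIC (W @^-1` D)) setIA.
- exact: aeW.
Qed.

End cond_indep.
End cond_prob.

(** * Expected divergence as a risk gap *)

Section proper_gap.
Context (R : realType) (d dF dW : measure_display) (Omega : measurableType d)
  (TF : measurableType dF) (TW : measurableType dW).
Variables (P : probability Omega R) (F : {mfun Omega >-> TF})
  (W : {mfun Omega >-> TW}).
Variables (Q : set (pprobability TF R)) (L : pprobability TF R -> TF -> \bar R).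
Hypotheses (mL : measurable_loss Q L) (pL : proper_loss Q L).

Let loss_extension : exists g : pprobability TF R * TF -> \bar R,
  measurable_fun [set: pprobability TF R * TF] g /\
  forall q f, Q q -> L q f = g (q, f).
Proof.
have [g [mg gE]] := trace_measurable_extension (f := fun z => L z.1 z.2) mL.
by exists g; split => // q f Qq; rewrite (gE (q, f)).
Qed.

(** Tower property: given [W] the report is fixed and [F] has law [s (W w)]. The loss is exchanged
    for its measurable extension before the disintegration and restored afterwards. *)
Lemma risk_expected_loss (s q : {mfun TW >-> pprobability TF R}) :
  disintegrates P W F (s \o W) ->
  {ae P, forall w, Q (q (W w))} -> risk P L F W q \is a fin_num ->
  risk P L F W q = \int[P]_w expected_loss L (s (W w)) (q (W w)).
Proof.
move=> ds Qq; have [g [mg gE]] := loss_extension.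
have mphi : measurable_fun [set: TW * TF] (fun z => g (q z.1, z.2)).
  apply: (measurableT_comp mg); apply/measurable_fun_pair => //.
  exact: measurableT_comp.
have -> : risk P L F W q = \int[P]_w g (q (W w), F w).
  by apply: ae_eq_integralT; apply: filterS Qq => w /gE.
move=> fin.
have msW : measurable_fun [set: Omega] (s \o W) by exact: measurableT_comp.
rewrite (disintegrates_fin_integral (measurable_funPT F) (measurable_funPT W)
  msW ds mphi fin).
apply: ae_eq_integralT; apply: filterS Qq => w Qw.
by apply: eq_integral => f _; rewrite gE.
Qed.

(* [S] may depend on more than [W], whereas [s] and the report [q] are functions
   of [W]. *)
Lemma divergence_gap (S : {mfun Omega >-> pprobability TF R})
    (s q : {mfun TW >-> pprobability TF R}) :
  disintegrates P W F S -> disintegrates P W F (s \o W) ->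
  {ae P, forall w, Q (S w)} -> {ae P, forall w, Q (q (W w))} ->
  \int[P]_w bayes_loss L (S w) \is a fin_num ->
  \int[P]_w expected_loss L (s (W w)) (q (W w)) \is a fin_num ->
  [/\ \int[P]_w divergence L (S w) (q (W w)) =
        \int[P]_w expected_loss L (s (W w)) (q (W w)) -
        \int[P]_w bayes_loss L (S w),
      0 <= \int[P]_w divergence L (S w) (q (W w)) &
      strictly_proper_loss Q L ->
        (\int[P]_w divergence L (S w) (q (W w)) = 0 <->
         {ae P, forall w, same_law (S w) (q (W w))})].
Proof.
move=> dS ds QS Qq; have [g [mg gE]] := loss_extension.
(* [H] and [E] are everywhere measurable stand-ins for the Bayes loss of [S] and the expected loss
   of [q] under [S], equal to them off null sets. *)
pose phi (z : TW * TF) := g (q z.1, z.2).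
pose H w := \int[S w : probability TF R]_f g (S w, f).
pose E w := \int[S w : probability TF R]_f phi (W w, f).
have mS : measurable_fun [set: Omega] S by exact: measurable_funPT.
have mphi : measurable_fun [set: TW * TF] phi.
  apply: (measurableT_comp mg); apply/measurable_fun_pair => //.
  exact: measurableT_comp.
have mH : measurable_fun [set: Omega] H.
  apply: (measurable_expectation (phi := fun z => g (S z.1, z.2))) => //.
  apply: (measurableT_comp mg); apply/measurable_fun_pair => //.
  exact: measurableT_comp.
have mE : measurable_fun [set: Omega] E by exact: measurable_expectation_comp.
have HE : {ae P, forall w, bayes_loss L (S w) = H w}.
  by apply: filterS QS => w Qw; apply: eq_integral => f _; rewrite gE.
have EE p : {ae P, forall w, expected_loss L (p w) (q (W w)) =
    \int[p w : probability TF R]_f phi (W w, f)}.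
  by apply: filterS Qq => w Qw; apply: eq_integral => f _; rewrite gE.
have DE : {ae P, forall w, divergence L (S w) (q (W w)) = E w - H w}.
  by apply: filterS2 HE (EE S) => w HEw EEw; congr (_ - _).
rewrite (ae_eq_integralT HE) (ae_eq_integralT (EE (s \o W))) => Hfin Efin.
rewrite (ae_eq_integralT DE).
have intH : P.-integrable [set: Omega] H by exact: fin_num_integrable.
have Hfin_ae : {ae P, forall w, H w \is a fin_num}.
  by apply: filterS (integrable_ae measurableT intH) => w; exact.
have HleE : {ae P, forall w, H w <= E w}.
  near=> w.
  have <- : bayes_loss L (S w) = H w by near: w.
  have <- : expected_loss L (S w) (q (W w)) = E w by near: w; exact: EE.
  by apply: pL; near: w.
have D0 : {ae P, forall w, 0 <= E w - H w}.
  by apply: filterS2 Hfin_ae HleE => w Hw; rewrite sube_ge0 ?Hw.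
(* For an absolute value, a zero integral is the same as vanishing almost surely. *)
have Dabs : \int[P]_w (E w - H w) = \int[P]_w `|E w - H w|.
  by apply: ae_eq_integralT; apply: filterS D0 => w /gee0_abs.
split.
- exact: (disintegrates_integral_gap (measurable_funPT F) (measurable_funPT W)
    mS dS (measurable_funPT s) ds mphi).
- by rewrite Dabs integral_ge0.
move=> [_ strict]; rewrite Dabs.
apply: iff_trans (ae_eq_integral_abs P measurableT _) _.
  exact: emeasurable_funB.
split=> [Deq0|same].
- have D00 : {ae P, forall w, E w - H w = 0}.
    by apply: filterS Deq0 => w /(_ I).
  near=> w.
  have Hw : H w \is a fin_num by near: w.
  have D0w : E w - H w = 0 by near: w.
  have Qw : Q (S w) by near: w.
  have Qqw : Q (q (W w)) by near: w.
  have EHw : expected_loss L (S w) (q (W w)) = expected_loss L (S w) (S w).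
    have -> : expected_loss L (S w) (q (W w)) = E w by near: w; exact: EE.
    have -> : expected_loss L (S w) (S w) = H w by near: w.
    by rewrite -(subeK (E w) Hw) D0w add0e.
  by move=> B mB; rewrite (strict _ _ Qw Qqw EHw).
(* Equal laws need not be Leibniz equal, but the measurable extension [g] takes the same values at
   both. *)
- apply: filterS2 Hfin_ae same => w Hw same _ /=.
  suff -> : E w = H w by rewrite subee.
  by apply: eq_integral => f _; rewrite (same_law_measurable_fun _ mg same).
Unshelve. all: by end_near. Qed.

End proper_gap.

Section fin_num_gaps.
Context (R : realType).

Lemma sube_eq0_fin (x y : \bar R) :
  x \is a fin_num -> y \is a fin_num -> (x - y = 0 <-> x = y).
Proof.
move=> xfin yfin; split=> [xy0|->]; last exact: subee.
by rewrite -(subeK x yfin) xy0 add0e.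
Qed.

Lemma le_chain_gaps (x y v r : \bar R) :
  x \is a fin_num -> y \is a fin_num -> v \is a fin_num -> r \is a fin_num ->
  x <= y -> y <= v -> v <= r ->
  (r = x <-> [/\ y - x = 0, v - y = 0 & r - v = 0]).
Proof.
move=> xfin yfin vfin rfin xy yv vr; split=> [rx|[]].
- have yx : y = x.
    by apply/eqP; rewrite eq_le xy -[X in _ <= X]rx (le_trans yv vr).
  have vx : v = x.
    by apply/eqP; rewrite eq_le (le_trans xy yv) -[X in _ <= X]rx vr.
  by rewrite rx vx yx; split; exact: subee.
by move=> /sube_eq0_fin -> // /sube_eq0_fin -> // /sube_eq0_fin ->.
Qed.

End fin_num_gaps.

(** * Assembly of the three gaps *)

Theorem corollary1 (R : realType)
  (d dC dX dF dY : measure_display)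
  (Omega : measurableType d) (P : probability Omega R)
  (TC : measurableType dC) (TX : measurableType dX)
  (TF : measurableType dF) (TY : measurableType dY)
  (hTC : standard_borel R TC) (hTX : standard_borel R TX)
  (hTF : standard_borel R TF) (hTY : standard_borel R TY)
  (C : {RV P >-> TC}) (X : {RV P >-> TX})
  (F : {RV P >-> TF}) (Y : {RV P >-> TY})
  (XC := fun w => (X w, C w)) (YC := fun w => (Y w, C w))
  (hMarkov : cond_indep P F Y XC)
  (Q : set (pprobability TF R))
  (L : pprobability TF R -> TF -> \bar R)
  (hLmeas : measurable_loss Q L)
  (hLproper : proper_loss Q L)
  (SX : {mfun (TX * TC)%type >-> pprobability TF R})
  (SY : {mfun (TY * TC)%type >-> pprobability TF R})
  (hSX : is_cond_law P F XC SX)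
  (hSY : is_cond_law P F YC SY)
  (hSXQ : {ae P, forall w, Q (SX (XC w))})
  (hSYQ : {ae P, forall w, Q (SY (YC w))})
  (V : set {mfun (TY * TC)%type >-> pprobability TF R})
  (hV0 : V !=set0)
  (hVQ : forall q, V q -> {ae P, forall w, Q (q (YC w))})
  (Qtheta : {mfun (TY * TC)%type >-> pprobability TF R})
  (hQtheta : V Qtheta)
  (HX := cond_entropy P L XC SX)
  (HY := cond_entropy P L YC SY)
  (HV := family_entropy P L F YC V)
  (Rtheta := risk P L F YC Qtheta)
  (hHX : HX \is a fin_num) (hHY : HY \is a fin_num)
  (hHV : HV \is a fin_num) (hRtheta : Rtheta \is a fin_num)
  (Dcomm := HY - HX) (Dfamily := HV - HY) (Ddeploy := Rtheta - HV) :
  [/\ (Rtheta = HX <->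
         \int[P]_w divergence L (SX (XC w)) (Qtheta (YC w)) = 0),
      (Rtheta = HX <-> [/\ Dcomm = 0, Dfamily = 0 & Ddeploy = 0]) &
      strictly_proper_loss Q L ->
        [/\ (Dcomm = 0 <-> {ae P, forall w, same_law (SX (XC w)) (SY (YC w))}),
            (Dcomm = 0 <-> cond_indep P F X YC) &
            forall Qstar, risk_argmin P L F YC V Qstar ->
              [/\ (Dfamily = 0 <->
                     {ae P, forall w, same_law (Qstar (YC w)) (SY (YC w))}),
                  (Ddeploy = 0 <-> risk_argmin P L F YC V Qtheta) &
                  (Rtheta = HX ->
                     [/\ cond_indep P F X YC,
                         (exists2 q, V q &
                            {ae P, forall w, same_law (q (YC w)) (SY (YC w))}) &
                         risk_argmin P L F YC V Qtheta])]]].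
Proof.
have mXC : measurable_fun [set: Omega] XC by exact/measurable_fun_pair.
have mYC : measurable_fun [set: Omega] YC by exact/measurable_fun_pair.
pose XCm : {mfun Omega >-> (TX * TC)%type} :=
  HB.pack XC (isMeasurableFun.Build _ _ _ _ _ mXC).
pose YCm : {mfun Omega >-> (TY * TC)%type} :=
  HB.pack YC (isMeasurableFun.Build _ _ _ _ _ mYC).
have mSXW : measurable_fun [set: Omega] (SX \o XC) by exact: measurableT_comp.
have mSYW : measurable_fun [set: Omega] (SY \o YC) by exact: measurableT_comp.
pose SXm : {mfun Omega >-> pprobability TF R} :=
  HB.pack (SX \o XC) (isMeasurableFun.Build _ _ _ _ _ mSXW).
pose SYm : {mfun Omega >-> pprobability TF R} :=
  HB.pack (SY \o YC) (isMeasurableFun.Build _ _ _ _ _ mSYW).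
have dSX : disintegrates P XC F (SX \o XC) by move=> D B mD mB; exact: (hSX B mB).2.
have dSY : disintegrates P YC F (SY \o YC) by move=> D B mD mB; exact: (hSY B mB).2.
(* The only use of the Markov property; the next two facts rearrange or forget coordinates. *)
have dSXYC : disintegrates P (fun w => (Y w, XC w)) F (SX \o XC).
  exact: (@cond_indep_disintegrates _ _ _ _ _ P XCm _ _ _ _ F Y SX hSX hMarkov).
have dSX_YC : disintegrates P YC F (SX \o XC).
  apply: (disintegrates_comp (h := fun z => (z.1, z.2.2)) _ dSXYC).
  apply/measurable_fun_pair => //.
  by apply: measurableT_comp => //; exact: measurable_snd.
have dSX_XYC : disintegrates P (fun w => (X w, YC w)) F (SX \o XC).
  apply: (disintegrates_comp (h := fun z => (z.2.1, (z.1, z.2.2))) _ dSXYC).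
  apply/measurable_fun_pair => /=.
    by apply: measurableT_comp => //; exact: measurable_fst.
  apply/measurable_fun_pair => //.
  by apply: measurableT_comp => //; exact: measurable_snd.
have riskE q : V q -> risk P L F YC q \is a fin_num ->
    risk P L F YC q = \int[P]_w expected_loss L (SY (YC w)) (q (YC w)).
  by move=> Vq; exact: (risk_expected_loss (W := YCm) hLmeas dSY (hVQ _ Vq)).
(* With report [SY], the mean expected loss under [SY] is by definition [HY]. *)
have gap_comm := divergence_gap (W := YCm) (S := SXm) hLmeas hLproper
  dSX_YC dSY hSXQ hSYQ hHX hHY.
have gap_theta : \int[P]_w divergence L (SX (XC w)) (Qtheta (YC w)) = Rtheta - HX.
  have := riskE _ hQtheta hRtheta; move: hRtheta; rewrite /Rtheta => /[swap] -> fin.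
  by have [] := divergence_gap (W := YCm) (S := SXm) hLmeas hLproper
    dSX_YC dSY hSXQ (hVQ _ hQtheta) hHX fin.
have gap_family q : V q -> risk P L F YC q \is a fin_num ->
    0 <= risk P L F YC q - HY /\
    (strictly_proper_loss Q L -> (risk P L F YC q - HY = 0 <->
       {ae P, forall w, same_law (SY (YC w)) (q (YC w))})).
  move=> Vq qfin; have := qfin; rewrite (riskE _ Vq qfin) => fin.
  have [gapE gap0 gapS] := divergence_gap (W := YCm) (S := SYm) hLmeas hLproper
    dSY dSY hSYQ (hVQ _ Vq) hHY fin.
  by rewrite -/HY -gapE.
have [commE comm0 commS] := gap_comm.
have HXY : HX <= HY by rewrite -sube_ge0 ?hHX// -commE.
have HVle q : V q -> HV <= risk P L F YC q.
  by move=> Vq; apply: ereal_inf_lbound; exists q.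
have HYV : HY <= HV.
  apply: le_ereal_inf_tmp => _ [q Vq <-].
  (* A risk that is not finite is either +oo, where the bound is trivial, or -oo, which would make
     the finite infimum [HV] equal to -oo. *)
  have [qfin|] := boolP (risk P L F YC q \is a fin_num).
    by rewrite -sube_ge0 ?hHY//; exact: (gap_family q Vq qfin).1.
  rewrite fin_numE negb_and !negbK => /orP[/eqP qoo|/eqP->]; last exact: leey.
  by have := HVle q Vq; rewrite qoo leeNy_eq => /eqP HVoo; rewrite HVoo in hHV.
have HVR : HV <= Rtheta by exact: HVle.
have chain := le_chain_gaps hHX hHY hHV hRtheta HXY HYV HVR.
split=> //.
  by rewrite gap_theta; apply: iff_sym; exact: sube_eq0_fin.
move=> strict.
have comm_same : Dcomm = 0 <->
    {ae P, forall w, same_law (SX (XC w)) (SY (YC w))}.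
  by rewrite /Dcomm -[HY - HX]commE; exact: commS.
have comm_indep : Dcomm = 0 <-> cond_indep P F X YC.
  split.
    move=> /comm_same same.
    apply: (@disintegrates_cond_indep _ _ _ _ _ P YCm _ _ _ _ F X SY hSY).
    move=> D B mD mB.
    have mXYC : measurable_fun [set: Omega] (fun w => (X w, YC w)).
      exact/measurable_fun_pair.
    have mpre : measurable ((fun w => (X w, YC w)) @^-1` D).
      by rewrite -[X in measurable X]setTI; exact: mXYC.
    (* [SX] disintegrates [F] over (X,Y,C), and the almost sure equality passes this on to [SY]. *)
    rewrite -[RHS](dSX_XYC D B mD mB); apply: ae_eq_integral => //.
    - by apply: measurable_funTS; exact: measurable_eval.
    - by apply: measurable_funTS; exact: measurable_eval.
    by apply: filterS same => w same _; rewrite /= (same B mB).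
  move=> /(@cond_indep_disintegrates _ _ _ _ _ P YCm _ _ _ _ F X SY hSY) dSXC.
  have dSY_XC : disintegrates P XC F (SY \o YC).
    apply: (disintegrates_comp (h := fun z => (z.1, z.2.2)) _ dSXC).
    apply/measurable_fun_pair => //.
    by apply: measurableT_comp => //; exact: measurable_snd.
  (* Now [SY] is the state and [SX] the report, a function of (X,C); the nonnegative expected
     divergence is [HX - HY]. *)
  have [gapE gap0 _] := divergence_gap (W := XCm) (S := SYm) hLmeas hLproper
    dSY_XC dSX hSYQ hSXQ hHY hHX.
  have HYX : HY <= HX by rewrite -sube_ge0 ?hHY// -gapE.
  by apply/sube_eq0_fin => //; apply/eqP; rewrite eq_le HXY HYX.
split=> // Qstar Qstar_min; have [VQstar Qstar_le] := Qstar_min.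
have HVE : HV = risk P L F YC Qstar.
  apply/eqP; rewrite eq_le HVle//=.
  by apply: le_ereal_inf_tmp => _ [q Vq <-]; exact: Qstar_le.
have family_same : Dfamily = 0 <->
    {ae P, forall w, same_law (Qstar (YC w)) (SY (YC w))}.
  have Qstar_fin : risk P L F YC Qstar \is a fin_num by rewrite -HVE.
  have [_ /(_ strict) same] := gap_family Qstar VQstar Qstar_fin.
  rewrite /Dfamily HVE; apply: iff_trans same _.
  by split; apply: filterS => w same B mB; rewrite same.
have deploy_min : Ddeploy = 0 <-> risk_argmin P L F YC V Qtheta.
  apply: iff_trans (sube_eq0_fin hRtheta hHV) _; split=> [RV|[_ Rmin]].
    by split=> // q Vq; rewrite -/Rtheta RV; exact: HVle.
  by apply/eqP; rewrite eq_le HVR andbT HVE; exact: Rmin.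
split=> // /chain[/comm_indep indep /family_same same /deploy_min min].
by split=> //; exists Qstar.
Qed.
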